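(* For all reduced sequences $\overline{x},\overline{y},\overline{w}\in\mathsf{rseq}$: $\mathsf{red}(\overline{x}\overline{w})=\mathsf{red}(\overline{y}\overline{w})$ if and only if $\overline{x}=\overline{y}$.
   Context: $\mathsf{seq}$ is the set of finite sequences over $\{l,r,\lambda,\rho,n\}$ (juxtaposition = concatenation, $\varepsilon$ the empty sequence). One-step reduction $\rightsquigarrow'$ is generated by: $\overline{x}l\lambda\overline{y}\rightsquigarrow'\overline{x}\rho\overline{y}$; $\overline{x}r\lambda\overline{y}\rightsquigarrow'\overline{x}\overline{y}$; $\overline{x}\lambda r\overline{y}\rightsquigarrow'\overline{x}\overline{y}$; $\overline{x}\rho r\overline{y}\rightsquigarrow'\overline{x}l\overline{y}$; $\overline{x}nn\overline{y}\rightsquigarrow'\overline{x}\overline{y}$. A sequence is reduced if no step applies; $\mathsf{rseq}$ is the set of reduced sequences. $\rightsquigarrow$ is the reflexive-transitive closure of $\rightsquigarrow'$, and $\mathsf{red}(\overline{z})$ denotes the unique reduced sequence to which $\overline{z}$ reduces. *)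

(* Defs.v *)
From Stdlib Require Export Relations.Relation_Operators.
From mathcomp Require Export all_boot.

Set Implicit Arguments.
Unset Strict Implicit.
Unset Printing Implicit Defensive.

Inductive letter : Set := l_ | r_ | lambda_ | rho_ | n_.

Inductive step : seq letter -> seq letter -> Prop :=
| step_l_lambda x y : step (x ++ [:: l_; lambda_] ++ y) (x ++ [:: rho_] ++ y)
| step_r_lambda x y : step (x ++ [:: r_; lambda_] ++ y) (x ++ y)
| step_lambda_r x y : step (x ++ [:: lambda_; r_] ++ y) (x ++ y)
| step_rho_r x y : step (x ++ [:: rho_; r_] ++ y) (x ++ [:: l_] ++ y)
| step_n_n x y : step (x ++ [:: n_; n_] ++ y) (x ++ y).

Definition reduces : seq letter -> seq letter -> Prop :=
  clos_refl_trans (seq letter) step.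

Definition rseq (z : seq letter) : Prop := forall z', ~ step z z'.

(* [norm] is auxiliary: it only serves to prove that each sequence reduces to
   exactly one reduced sequence.  [push a s] is the reduced form of [a :: s]
   when [s] is reduced. *)
Definition push (a : letter) (s : seq letter) : seq letter :=
  match a, s with
  | l_, lambda_ :: t => rho_ :: t
  | r_, lambda_ :: t => t
  | lambda_, r_ :: t => t
  | rho_, r_ :: t => l_ :: t
  | n_, n_ :: t => t
  | _, _ => a :: s
  end.

Definition norm (z : seq letter) : seq letter := foldr push [::] z.

Lemma step_cons a s t : step s t -> step (a :: s) (a :: t).
Proof.
case=> x y; rewrite -!cat_cons.
- exact: step_l_lambda.
- exact: step_r_lambda.
- exact: step_lambda_r.
- exact: step_rho_r.
- exact: step_n_n.
Qed.

Lemma rseq_behead a s : rseq (a :: s) -> rseq s.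
Proof. by move=> h t /(step_cons a) /h. Qed.

Lemma reduces_cons a s t : reduces s t -> reduces (a :: s) (a :: t).
Proof.
elim=> [x y h|x|x y z _ h1 _ h2].
- by apply: rt_step; apply: step_cons.
- exact: rt_refl.
- exact: rt_trans h1 h2.
Qed.

Lemma reduces_push a s : reduces (a :: s) (push a s).
Proof.
case: a s => [] [|[] s] /=; try exact: rt_refl; apply: rt_step.
- exact: (step_l_lambda [::]).
- exact: (step_r_lambda [::]).
- exact: (step_lambda_r [::]).
- exact: (step_rho_r [::]).
- exact: (step_n_n [::]).
Qed.

Lemma reduces_norm z : reduces z (norm z).
Proof.
elim: z => [|a z IH]; first exact: rt_refl.
by apply: rt_trans (reduces_cons a IH) _; apply: reduces_push.
Qed.

Lemma push_rseq a s : rseq (a :: s) -> push a s = a :: s.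
Proof.
case: a s => [] [|[] s] //= h.
- by case: (h _ (step_l_lambda [::] s)).
- by case: (h _ (step_r_lambda [::] s)).
- by case: (h _ (step_lambda_r [::] s)).
- by case: (h _ (step_rho_r [::] s)).
- by case: (h _ (step_n_n [::] s)).
Qed.

Lemma norm_rseq z : rseq z -> norm z = z.
Proof.
by elim: z => [|a z IH] //= h; rewrite (IH (rseq_behead h)) push_rseq.
Qed.

Lemma cons2_neq (a b : letter) s : s <> [:: a, b & s].
Proof. by move=> /(congr1 size)/eqP; rewrite /= ltn_eqF // ltnS leqnSn. Qed.

Lemma step_consE a s t : step (a :: s) t ->
  push a s <> a :: s \/ exists t', step s t'.
Proof.
move e: (a :: s) => u h.
case: h e => -[|c x] y /= [-> ->] /=;
  try (by left; first [done | apply: cons2_neq]); right; eexists.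
- exact: step_l_lambda.
- exact: step_r_lambda.
- exact: step_lambda_r.
- exact: step_rho_r.
- exact: step_n_n.
Qed.

Lemma rseq_of_push a s : rseq s -> push a s = a :: s -> rseq (a :: s).
Proof. by move=> hs hp t /step_consE [/(_ hp)|[t' /hs]]. Qed.

Lemma rseq_push a s : rseq s -> rseq (push a s).
Proof.
case: s => [|b t] hs; first by case: a; apply: rseq_of_push hs _.
have ht := rseq_behead hs; have := push_rseq hs.
case: a b hs => [] [] hs //= hp; try (by apply: rseq_of_push hs _);
  apply: rseq_of_push ht _; case: t hp {hs} => [|[] t] //= hp;
  by case: (cons2_neq hp).
Qed.

Lemma norm_reduced z : rseq (norm z).
Proof.
elim: z => [|a z IH] /=; last exact: rseq_push.
by move=> t h; move e: [::] h => u h; case: h e => -[].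
Qed.

Lemma norm_step s t : step s t -> norm s = norm t.
Proof.
have key a b c x y :
    (forall u, rseq u -> push a (push b u) = foldr push u c) ->
  norm (x ++ [:: a; b] ++ y) = norm (x ++ c ++ y).
  move=> h; rewrite /norm !foldr_cat /= h //; exact: norm_reduced.
have fin (a b : letter) u (P : Prop) : u = [:: a, b & u] -> P.
  by move=> h; case: (cons2_neq h).
case=> x y; [apply: (key _ _ [:: rho_]) | apply: (key _ _ [::])
  | apply: (key _ _ [::]) | apply: (key _ _ [:: l_]) | apply: (key _ _ [::])];
  move=> [|[] u] //= /push_rseq //=; case: u => [|[] u] //=; exact: fin.
Qed.

Lemma norm_reduces s t : reduces s t -> norm s = norm t.
Proof. by elim=> [x y /norm_step||x y z _ -> _ ->]. Qed.

Lemma reduced_form_exists z : {w | reduces z w /\ rseq w}.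
Proof.
by exists (norm z); split; [apply: reduces_norm | apply: norm_reduced].
Qed.

Lemma reduced_form_unique z w w' :
  reduces z w -> rseq w -> reduces z w' -> rseq w' -> w = w'.
Proof.
move=> /norm_reduces h /norm_rseq <- /norm_reduces h' /norm_rseq <-.
by rewrite -h -h'.
Qed.

Definition red (z : seq letter) : seq letter := sval (reduced_form_exists z).

Lemma redP z : reduces z (red z) /\ rseq (red z).
Proof. exact: (svalP (reduced_form_exists z)). Qed.

Lemma red_unique z w : reduces z w -> rseq w -> red z = w.
Proof.
by move=> h hw; case: (redP z) => h1 h2; apply: reduced_form_unique h1 h2 h hw.
Qed.

(* Main.v *)
(** Modulo reduction, [r_] and [lambda_] are mutually inverse and [n_] is its own
    inverse, so these letters cancel on the right.  The remaining letters [l_]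
    and [rho_] are never the second letter of a redex, so appending one of them
    to a reduced sequence creates no redex.  Hence any [w] cancels letter by
    letter. *)
Require Import Defs.

Lemma red_norm z : red z = norm z.
Proof. exact: red_unique (reduces_norm z) (@norm_reduced z). Qed.

Lemma step_catr w s t : step s t -> step (s ++ w) (t ++ w).
Proof.
case=> x y; rewrite -!catA.
- exact: step_l_lambda.
- exact: step_r_lambda.
- exact: step_lambda_r.
- exact: step_rho_r.
- exact: step_n_n.
Qed.

Lemma reduces_catr w s t : reduces s t -> reduces (s ++ w) (t ++ w).
Proof.
elim=> [x y h|x|x y z _ h1 _ h2].
- by apply: rt_step; apply: step_catr.
- exact: rt_refl.
- exact: rt_trans h1 h2.
Qed.

(** Reductions of the prefix survive appending [w], and [norm] is invariant under reduction. *)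
Lemma norm_catl x w : norm (norm x ++ w) = norm (x ++ w).
Proof. exact/esym/norm_reduces/reduces_catr/reduces_norm. Qed.

Lemma norm_cat_inverse a b x :
  (forall z, step (z ++ [:: a; b] ++ [::]) (z ++ [::])) ->
  norm (norm (x ++ [:: a]) ++ [:: b]) = norm x.
Proof. by move=> /(_ x)/norm_step; rewrite !cats0 norm_catl -catA. Qed.

Lemma norm_cat_irreducible a x :
  (forall b, push b [:: a] = [:: b; a]) ->
  norm (x ++ [:: a]) = norm x ++ [:: a].
Proof.
move=> ha; rewrite -norm_catl; have := @norm_reduced x.
elim: (norm x) => [|b s IH] hs; first by case: {ha hs} a (ha a).
rewrite /= (IH (rseq_behead hs)).
case: s hs {IH} => [_|c s /push_rseq]; first exact: ha.
(* As [b :: c :: s] is reduced, [b] and [c] form no redex, and [push] looks no further than these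
   two letters. *)
by case: b c => [] [] //= h; case: (cons2_neq h).
Qed.

Lemma norm_cat1_inj a x y :
  norm (x ++ [:: a]) = norm (y ++ [:: a]) -> norm x = norm y.
Proof.
have inverse b : (forall z, step (z ++ [:: a; b] ++ [::]) (z ++ [::])) ->
    norm (x ++ [:: a]) = norm (y ++ [:: a]) -> norm x = norm y.
  (* Appending [b] to both sides of [e] and normalizing again undoes [a]. *)
  by move=> ab e; rewrite -(@norm_cat_inverse a b x) // e norm_cat_inverse.
have irreducible : (forall b, push b [:: a] = [:: b; a]) ->
    norm (x ++ [:: a]) = norm (y ++ [:: a]) -> norm x = norm y.
  by move=> ha; rewrite !norm_cat_irreducible // !cats1 => /rcons_inj [].
case: a inverse irreducible => inverse irreducible.
- by apply: irreducible; case.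
- by apply: (inverse lambda_) => z; apply: step_r_lambda.
- by apply: (inverse r_) => z; apply: step_lambda_r.
- by apply: irreducible; case.
- by apply: (inverse n_) => z; apply: step_n_n.
Qed.

Lemma norm_cat_inj w x y : norm (x ++ w) = norm (y ++ w) -> norm x = norm y.
Proof.
(* The head of [w] moves to the end of [x] and of [y], which may create redexes; hence the induction
   runs over all [x] and [y], reduced or not. *)
elim: w x y => [|a w IH] x y; first by rewrite !cats0.
by rewrite -(cat1s a w) !catA => /IH /norm_cat1_inj.
Qed.

Theorem theorem26 (x y w : seq letter) (hx : rseq x) (hy : rseq y) (hw : rseq w) :
  red (x ++ w) = red (y ++ w) <-> x = y.
Proof.
split=> [|-> //]; rewrite !red_norm => /norm_cat_inj.
by rewrite !norm_rseq.
Qed.
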